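(* Let $G$ be a simple graph on $\ell$ vertices and let $G+v$ be the graph obtained by adding a new vertex $v$ adjacent to all vertices of $G$. Let $1\le k\le\ell-1$. If $\mathcal{A}_G$ is $k$-coaccurate, then so is $\mathcal{A}_{G+v}$. In particular, if $\mathcal{A}_G$ is accurate (respectively flag-accurate), then so is $\mathcal{A}_{G+v}$.
   Context: Let $\mathbb{K}$ be a field. For a simple graph $G$ with vertices $v_1,\dots,v_n$, the graphic arrangement in $\mathbb{K}^n$ is $\mathcal{A}_G=\{\ker(x_i-x_j):\{v_i,v_j\}\text{ an edge}\}$ (so $\mathcal{A}_G\subseteq\mathbb{K}^\ell$ and $\mathcal{A}_{G+v}\subseteq\mathbb{K}^{\ell+1}$). For a central arrangement $\mathcal{A}$ in $V=\mathbb{K}^n$: $L(\mathcal{A})$ is the set of intersections of subsets of $\mathcal{A}$ (including $V$); $\mathcal{A}^X=\{H\cap X:H\in\mathcal{A},X\not\subseteq H\}$; $\mathcal{A}$ is free if $D(\mathcal{A})=\{\theta\in\mathrm{Der}(S):\theta(\alpha_H)\in\alpha_HS\ \forall H\}$ is free over $S=\mathbb{K}[x_1,\dots,x_n]$, exponents being degrees of a homogeneous basis. If $\mathcal{A}$ is free with exponents $e_1\le\dots\le e_n$, a witness for accuracy is a tuple $(X_1,\dots,X_n)$ of flats with $\dim X_d=d$ and $\mathcal{A}^{X_d}$ free with exponents $(e_1,\dots,e_d)$; $\mathcal{A}$ is accurate if a witness exists and flag-accurate if a witness with $X_1\subseteq\dots\subseteq X_n$ exists. For $1\le j\le n-1$,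 $\mathcal{A}$ is $j$-coaccurate if there is a witness for accuracy with $X_1\subseteq\dots\subseteq X_{n-j}$. *)

(* Defs.v *)
From HB Require Import structures.
From mathcomp Require Import all_boot all_order all_algebra.
From mathcomp Require Import finmap.
From mathcomp Require Import mpoly.

Set Implicit Arguments.
Unset Strict Implicit.
Unset Printing Implicit Defensive.

Import GRing.Theory.
Local Open Scope ring_scope.

Record sgraph (n : nat) := SGraph {
  edge : rel 'I_n;
  edge_sym : ssrbool.symmetric edge;
  edge_irr : ssrbool.irreflexive edge }.

(* The added vertex of the cone is [ord_max]. *)
Definition cone_edge n (G : sgraph n) : rel 'I_n.+1 := fun i j =>
  match unlift ord_max i, unlift ord_max j with
  | Some i', Some j' => edge G i' j'
  | None, None => false
  | _, _ => true
  end.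

Lemma cone_edge_sym n (G : sgraph n) : ssrbool.symmetric (cone_edge G).
Proof.
move=> i j; rewrite /cone_edge.
by case: (unlift _ i) => [i'|]; case: (unlift _ j) => [j'|] //; exact: edge_sym.
Qed.

Lemma cone_edge_irr n (G : sgraph n) : ssrbool.irreflexive (cone_edge G).
Proof.
by move=> i; rewrite /cone_edge; case: (unlift _ i) => [i'|] //; exact: edge_irr.
Qed.

Definition cone n (G : sgraph n) : sgraph n.+1 :=
  SGraph (cone_edge_sym G) (cone_edge_irr G).

Section Arrangements.
Variable K : fieldType.

(* Only finite sets of linear hyperplanes (subspaces of codimension 1) are
   meant. *)
Definition arrangement (n : nat) := {fset {vspace 'rV[K]_n}}.

Definition coord_diff n (i j : 'I_n) (v : 'rV[K]_n) : K^o := v 0 i - v 0 j.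

Lemma coord_diff_is_linear n (i j : 'I_n) : linear (coord_diff i j).
Proof.
by move=> a u v; rewrite /coord_diff !mxE opprD addrACA -mulrBr.
Qed.

HB.instance Definition _ n (i j : 'I_n) :=
  GRing.isLinear.Build K 'rV[K]_n K^o _ (coord_diff i j)
    (coord_diff_is_linear i j).

Definition graphic n (G : sgraph n) : arrangement n :=
  [fset lker (linfun (coord_diff p.1 p.2)) |
    p in [pred p : 'I_n * 'I_n | edge G p.1 p.2]]%fset.

Definition flat n (A : arrangement n) (X : {vspace 'rV[K]_n}) : Prop :=
  exists2 B : arrangement n, (B `<=` A)%fset & X = (\bigcap_(H <- B) H)%VS.

Definition restriction n (A : arrangement n) (X : {vspace 'rV[K]_n}) :
    arrangement n :=
  [fset (H :&: X)%VS | H in A & ~~ (X <= H)%VS]%fset.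

Definition form_poly n (alpha : 'Hom('rV[K]_n, K^o)) : {mpoly K[n]} :=
  \sum_(i < n) (alpha (delta_mx 0 i) : K) *: 'X_i.

Definition derivation n (theta : {mpoly K[n]} -> {mpoly K[n]}) : Prop :=
  linear theta /\ forall p q, theta (p * q) = theta p * q + p * theta q.

Definition in_D n (A : arrangement n) (theta : {mpoly K[n]} -> {mpoly K[n]}) :
    Prop :=
  derivation theta /\
  forall (H : {vspace 'rV[K]_n}) (alpha : 'Hom('rV[K]_n, K^o)),
    H \in A -> lker alpha = H ->
    exists g : {mpoly K[n]}, theta (form_poly alpha) = form_poly alpha * g.

(* Polynomial degree: the derivation sends linear forms to forms of degree d. *)
Definition homogeneous n (d : nat) (theta : {mpoly K[n]} -> {mpoly K[n]}) :
    Prop :=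
  forall i : 'I_n, theta 'X_i \is d.-homog.

(* D(A) is a free module over K[x_1, ..., x_n] with a basis of homogeneous
   derivations of degrees e. *)
Definition free_with_exponents n (A : arrangement n) (e : seq nat) : Prop :=
  exists theta : 'I_(size e) -> {mpoly K[n]} -> {mpoly K[n]},
    [/\ forall i, in_D A (theta i),
        forall i : 'I_(size e), homogeneous (nth 0%N e i) (theta i)
      & forall eta, in_D A eta ->
          exists! f : {ffun 'I_(size e) -> {mpoly K[n]}},
            forall p, eta p = \sum_i f i * theta i p].

(* Freeness of an arrangement B of hyperplanes of the subspace X, read through
   a linear isomorphism phi from K^(dim X) onto X; the choice of phi is
   immaterial, since D(B) is compatible with linear changes of coordinates. *)
Definition free_in n (X : {vspace 'rV[K]_n}) (B : arrangement n)
    (e : seq nat) : Prop :=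
  exists phi : 'Hom('rV[K]_(\dim X), 'rV[K]_n),
    [/\ lker phi = 0%VS, limg phi = X
      & free_with_exponents [fset (phi @^-1: H)%VS | H in B]%fset e].

(* [X d] is the member of dimension d of the witness; the values of X outside
   1 <= d <= n are irrelevant. *)
Definition witness n (A : arrangement n) (X : nat -> {vspace 'rV[K]_n}) :
    Prop :=
  exists e : n.-tuple nat,
    [/\ free_with_exponents A e, sorted leq e
      & forall d, (1 <= d <= n)%N ->
          [/\ flat A (X d), \dim (X d) = d
            & free_in (X d) (restriction A (X d)) (take d e)]].

Definition chain n (X : nat -> {vspace 'rV[K]_n}) (m : nat) : Prop :=
  forall d, (1 <= d < m)%N -> (X d <= X d.+1)%VS.

Definition accurate n (A : arrangement n) : Prop :=
  exists X, witness A X.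

Definition flag_accurate n (A : arrangement n) : Prop :=
  exists2 X, witness A X & chain X n.

Definition coaccurate n (j : nat) (A : arrangement n) : Prop :=
  (1 <= j <= n.-1)%N /\ exists2 X, witness A X & chain X (n - j).

End Arrangements.

(* Main.v *)
From HB Require Import structures.
Require Import Defs.
From mathcomp Require Import all_boot all_order all_algebra.
From mathcomp Require Import finmap.
From mathcomp Require Import ring.
From mathcomp Require Import mpoly.

(** A derivation [theta] is recorded by its values [p_i = theta(x_i)]; it lies in
    [D(A_G)] iff [x_i - x_j] divides [p_i - p_j] for every edge [ij] (a spline on
    [G]).  On the cone, with new coordinate [y] and last value [c], the condition
    at the edges through the apex reads [p_i = c + (x_i - y) u_i], and then [p] is
    a spline iff [u] is one over [K[x, y]]: [y - x_j] is monic in [y], so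
    [x_i - x_j] divides [(x_j - y) (u_i - u_j)] only if it divides [u_i - u_j].
    Hence a basis [theta_k] of [D(A_G)] yields the basis
    [(1, ..., 1, 1), ((x_i - y) theta_k(x_i))_i followed by 0] for the cone, and
    exponents [e] become [(0, e + 1)].  The same computation applies to the restriction to a
    flat [X], since the coordinate functions restricted to [X] form, up to
    repetition, a basis of the dual of [X].  A witness [X_1, ..., X_l] for [G]
    therefore gives the witness consisting of the diagonal line followed by
    [X_1 x K, ..., X_l x K], and inclusions are preserved. *)

Set Implicit Arguments.
Unset Strict Implicit.
Unset Printing Implicit Defensive.

Import GRing.Theory.
Local Open Scope ring_scope.

(** * Polynomials in one more variable *)

Lemma polyCB_X_neq0 (S : idomainType) (b : S) : b%:P - 'X != 0.
Proof. by rewrite -opprB oppr_eq0 polyXsubC_eq0. Qed.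

(** Evaluation at [b] kills the left side, so for nonzero [a] the polynomial [g] has the root [b]
    and the factor [b - X] cancels; for [a = 0] it is [w] that vanishes. *)
Lemma polyC_dvd_cancel (S : idomainType) (a b : S) (w g : {poly S}) :
  (b%:P - 'X) * w = a%:P * g -> exists h, w = a%:P * h.
Proof.
have [-> /eqP|a0 e] := eqVneq a 0.
  rewrite mul0r mulf_eq0 (negPf (polyCB_X_neq0 b)) => /eqP ->.
  by exists 0; rewrite mulr0.
have /factor_theorem[q eq_g] : root g b.
  move/(congr1 (fun p => p.[b])): e.
  rewrite !hornerM hornerD hornerN !hornerC hornerX subrr mul0r.
  by move/esym/eqP; rewrite mulf_eq0 (negPf a0).
exists (- q); apply: (mulfI (polyCB_X_neq0 b)).
rewrite e eq_g; ring.
Qed.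

Section LastVariable.
Variables (n : nat) (R : idomainType).
Local Notation y := ('X_ord_max : {mpoly R[n.+1]}).

Lemma muniX : muni y = 'X.
Proof.
rewrite muniE msuppX big_seq1 mcoeffX eqxx scale1r mnm1E eqxx expr1.
rewrite (_ : [multinom _ | _ < _] = 0%MM) ?mpolyX0 ?scale1r //.
apply/mnmP=> i; rewrite mnmE mnm0E mnm1E; apply/eqP; rewrite eqb0.
by rewrite -val_eqE /= gtn_eqF.
Qed.

Lemma muni_mwiden (p : {mpoly R[n]}) : muni (mwiden p) = p%:P.
Proof.
elim/mpolyind: p => [|c m p _ _ ih]; first by rewrite !raddf0.
rewrite !raddfD /= mwidenZ muniZ ih mwidenX muniE msuppX big_seq1 mcoeffX eqxx.
rewrite mnmwiden_ordmax expr0 scale1r alg_polyC; congr (_ + _).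
rewrite (_ : [multinom _ | _ < _] = m) ?mul_polyC -?polyCM
  -?mul_mpolyC ?polyCM ?mul_polyC //.
by apply/mnmP=> i; rewrite mnmE mnmwiden_widen.
Qed.

(** With [mpwidenK], this identifies K[x, y] with K[x][y]. *)
Lemma muniK (p : {mpoly R[n.+1]}) : (mpwiden (muni p)).[y] = p.
Proof.
elim/mpolyind: p => [|c m p _ _ ih]; first by rewrite !raddf0 horner0.
rewrite muniD (rmorphD (@mpwiden n R)) hornerD; congr (_ + _); last exact: ih.
rewrite muniZ muniE msuppX big_seq1 mcoeffX eqxx scale1r.
rewrite -mul_polyC -mul_polyC !(rmorphM (@mpwiden n R)) /= !mpwidenC (rmorphXn
  (@mpwiden n R)) /= mpwidenX.
rewrite !hornerM !hornerC hornerXn mwidenC mul_mpolyC; congr (_ *: _).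
rewrite mwidenX mpolyXn -mpolyXD; congr 'X_[_].
apply/mnmP=> i; rewrite mnmDE mulmnE mnm1E.
case: (unliftP ord_max i) => [j|] ->; last first.
  by rewrite mnmwiden_ordmax eqxx mul1n.
have -> : lift ord_max j = widen_ord (leqnSn n) j by apply: val_inj; exact:
  lift_max.
rewrite mnmwiden_widen mnmE -val_eqE /= gtn_eqF ?mul0n ?addn0 //.
Qed.

Lemma muni_inj : injective (@muni n R).
Proof. by move=> p q e; rewrite -[p]muniK e muniK. Qed.

Lemma mwidenB_last_neq0 (a : {mpoly R[n]}) : mwiden a - y != 0.
Proof.
apply: contraNneq (polyCB_X_neq0 a) => /(congr1 (@muni n R)).
by rewrite muniB muni_mwiden muniX muni0 => ->.
Qed.

Lemma mwiden_dvd_cancel (a b : {mpoly R[n]}) (w g : {mpoly R[n.+1]}) :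
  (mwiden b - y) * w = mwiden a * g -> exists h, w = mwiden a * h.
Proof.
move=> /(congr1 (@muni n R)); rewrite !muniM muniB !muni_mwiden muniX.
case/polyC_dvd_cancel => h e; exists (mpwiden h).[y].
by rewrite -[w]muniK e (rmorphM (@mpwiden n R)) /= mpwidenC hornerM hornerC.
Qed.

Lemma mwiden_homog d (p : {mpoly R[n]}) : p \is d.-homog ->
  mwiden p \is d.-homog.
Proof.
move=> /dhomogP hp; rewrite [p]mpolyE raddf_sum /=.
rewrite big_seq; apply: rpred_sum => m /hp hm.
rewrite mwidenZ mwidenX rpredZ // dhomogX /= -hm !mdegE.
rewrite big_ord_recr /= mnmwiden_ordmax addn0.
by rewrite mdegE; apply/eqP; apply: eq_bigr => i _; rewrite mnmwiden_widen.
Qed.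

Lemma mpwidenK (q : {poly {mpoly R[n]}}) : muni (mpwiden q).[y] = q.
Proof.
elim/poly_ind: q => [|q c ih]; first by rewrite raddf0 horner0 muni0.
rewrite (rmorphD (@mpwiden n R)) (rmorphM (@mpwiden n R)) /= mpwidenX mpwidenC.
by rewrite hornerD hornerM hornerX hornerC muniD muniM muniX muni_mwiden ih.
Qed.

(** The coefficient of [y^t]. Being K[x]-linear, it splits a problem over K[x, y] with data in K[x]
    into problems over K[x]. *)
Definition coefy t (p : {mpoly R[n.+1]}) : {mpoly R[n]} := (muni p)`_t.

Lemma coefyB t : {morph coefy t : p q / p - q}.
Proof. by move=> p q; rewrite /coefy muniB coefB. Qed.

HB.instance Definition _ t := GRing.isZmodMorphism.Build _ _
  (coefy t) (@coefyB t).

Lemma coefyMw t p a : coefy t (p * mwiden a) = coefy t p * a.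
Proof. by rewrite /coefy muniM muni_mwiden coefMC. Qed.

Lemma coefy_eq0 t p : (size (muni p) <= t)%N -> coefy t p = 0.
Proof. exact: nth_default. Qed.

Lemma coefy_mpwiden t q : coefy t (mpwiden q).[y] = q`_t.
Proof. by rewrite /coefy mpwidenK. Qed.

Lemma coefy_inj p q : (forall t, coefy t p = coefy t q) -> p = q.
Proof. by move=> e; apply: muni_inj; apply/polyP. Qed.

End LastVariable.

(** * Splines *)

Definition vars m (R : comNzRingType) : 'rV[{mpoly R[m]}]_m := \row_a 'X_a.

(* Left transparent, these get unfolded during unification, which then hardly
   terminates. *)
Local Opaque mwiden muni coefy.

Local Notation "W ^M" := (map_mx (@mpolyC _ _) W) (at level 2, format "W ^M").
Local Notation "p ^w" := (map_mx (@mwiden _ _) p) (at level 2, format "p ^w").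

(* [Z] holds the vertex coordinates, so that the edge [ij] carries the linear
   form [Z_i - Z_j]. *)
Definition spline (S : pzRingType) n (E : rel 'I_n) (Z r : 'rV[S]_n) : Prop :=
  forall i j, E i j -> exists g, r 0 i - r 0 j = (Z 0 i - Z 0 j) * g.

(* The columns of [W] are the coordinate functions of K^n pulled back along
   K^m -> K^n; [vars m K *m W^M] lists them as polynomials, and the rows of [P]
   are derivations of K[x_1, ..., x_m] given by their values on variables. *)
Definition spline_basis (K : fieldType) m n r (E : rel 'I_n) (W : 'M[K]_(m, n))
    (d : nat -> nat) (P : 'M[{mpoly K[m]}]_(r, m)) : Prop :=
  [/\ forall k, spline E (vars m K *m W^M) (row k P *m W^M),
      forall (k : 'I_r) a, P k a \is (d k).-homog
    & forall q, spline E (vars m K *m W^M) (q *m W^M) ->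
        exists! f : 'rV_r, q = f *m P].

Lemma map_mxE (aT rT : Type) (f : aT -> rT) m n (A : 'M_(m, n)) i j :
  map_mx f A i j = f (A i j).
Proof. exact: mxE. Qed.

(** * Extension of scalars from K[x] to K[x, y] *)

Section Widen.
Variable K : fieldType.

Lemma map_mwidenC m k l (W : 'M[K]_(k, l)) :
  (W^M : 'M[{mpoly K[m]}]_(k, l))^w = W^M.
Proof. by rewrite -map_mx_comp; apply: eq_map_mx => c /=; rewrite mwidenC. Qed.

Lemma map_mwidenM m k l o (A : 'M[{mpoly K[m]}]_(k, l)) (B : 'M_(l, o)) :
  (A *m B)^w = A^w *m B^w.
Proof. exact: map_mxM. Qed.

Lemma coefy_mulmx m k l o t (A : 'M[{mpoly K[m.+1]}]_(k, l))
    (B : 'M[{mpoly K[m]}]_(l, o)) :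
  map_mx (coefy t) (A *m B^w) = map_mx (coefy t) A *m B.
Proof.
apply/matrixP=> i j; rewrite !mxE raddf_sum /=; apply: eq_bigr => a _.
by rewrite !mxE /= coefyMw.
Qed.

Lemma coefy_mulmxC m k l o t (A : 'M[{mpoly K[m.+1]}]_(k, l)) (W :
  'M[K]_(l, o)) :
  map_mx (coefy t) (A *m W^M) = map_mx (coefy t) A *m W^M.
Proof. by rewrite -map_mwidenC coefy_mulmx. Qed.

Lemma coefy_mx_inj m k l (A B : 'M[{mpoly K[m.+1]}]_(k, l)) :
  (forall t, map_mx (coefy t) A = map_mx (coefy t) B) -> A = B.
Proof.
move=> e; apply/matrixP=> i j; apply: coefy_inj => t.
by rewrite -[LHS]map_mxE e map_mxE.
Qed.

(** The edge forms do not involve [y], so each [y]-coefficient of [w] is a spline over K[x] with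
    unique coordinates in [P]; these are reassembled into polynomials in [y]. *)
Lemma widen_basis m n r E (W : 'M[K]_(m, n)) d (P : 'M[{mpoly K[m]}]_(r, m)) w :
  spline_basis E W d P -> spline E (vars m K *m W^M)^w (w *m W^M) ->
  exists! F : 'rV_r, w = F *m P^w.
Proof.
move=> [_ _ basisP] spl.
have spl_t t : spline E (vars m K *m W^M) (map_mx (coefy t) w *m W^M).
  move=> i j /spl[g e]; exists (coefy t g).
  by rewrite -coefy_mulmxC !map_mxE -coefyB e !map_mxE
    -mwidenB mulrC coefyMw mulrC.
(* From index [N] on all [y]-coefficients of [w] vanish, so finitely many expansions suffice. *)
pose N := (\max_a size (muni (w 0%R a)))%N.
have /fin_all_exists[f def_f] (t : 'I_N) :
    exists f, map_mx (coefy t) w = f *m P.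
  by have [f [? _]] := basisP _ (spl_t t); exists f.
pose h k : {poly {mpoly K[m]}} :=
  \poly_(t < N) (if insub t is Some u then f u 0 k else 0).
pose F := \row_k (mpwiden (h k)).['X_ord_max] : 'rV_r.
have coefF t : map_mx (coefy t) w = map_mx (coefy t) F *m P.
  have -> : map_mx (coefy t) F = if insub t is Some u then f u else 0.
    apply/rowP => k; rewrite map_mxE mxE coefy_mpwiden coef_poly.
    by case: insubP => [u -> _|/negPf ->]; rewrite ?mxE.
  case: insubP => [u _ <-|]; [exact: def_f | rewrite -leqNgt => leNt].
  rewrite mul0mx; apply/rowP => a; rewrite map_mxE [RHS]mxE coefy_eq0 //.
  exact: leq_trans (leq_bigmax a) leNt.
exists F; split=> [|F' def_F'].
  by apply: coefy_mx_inj => t; rewrite coefy_mulmx.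
(* The coefficients of any other solution [F'] solve the same problems over K[x]. *)
apply: coefy_mx_inj => t; have [g [_ uniq_g]] := basisP _ (spl_t t).
apply: etrans (esym (uniq_g _ (coefF t))) (uniq_g _ _).
by rewrite def_F' coefy_mulmx.
Qed.
End Widen.

(** * Splines on the cone *)

Section ConeAlgebra.
Variables (S : idomainType) (m n : nat) (s : 'I_m -> 'I_n) (b : 'I_n -> 'I_m).
Variables (W : 'M[S]_(m, n)) (C' : 'M[S]_m) (Z : 'rV[S]_n) (y : S).
Local Notation C := (colsub s W).
Hypothesis CK : C *m C' = 1%:M.
Hypothesis Wb : forall a i, W a i = W a (s (b i)).
Hypothesis Zb : forall i, Z 0 i = Z 0 (s (b i)).

(** [C] has inverse [C'], and every column of [W] repeats a column of [C]. On the vertex values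
    [q *m W], this endomorphism multiplies the [i]-th one by [Z_i - y]. *)
Definition cone_scale := C *m diag_mx (\row_j (Z 0 (s j) - y)) *m C'.
Definition cone_one : 'rV_m := const_mx 1 *m C'.
Local Notation T := cone_scale.

Lemma mulmx_colsub (q : 'rV_m) j : (q *m C) 0 j = (q *m W) 0 (s j).
Proof. by rewrite !mxE; apply: eq_bigr => a _; rewrite mxE. Qed.

Lemma mulmx_block (q : 'rV_m) i : (q *m W) 0 i = (q *m C) 0 (b i).
Proof. by rewrite mulmx_colsub !mxE; apply: eq_bigr => a _; rewrite Wb. Qed.

Lemma mulCK k (q : 'M_(k, m)) : q *m C' *m C = q.
Proof. by rewrite -mulmxA (mulmx1C CK) mulmx1. Qed.

Lemma cone_oneE i : (cone_one *m W) 0 i = 1.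
Proof. by rewrite mulmx_block mulCK mxE. Qed.

Lemma cone_scaleC (w : 'rV_m) j :
  (w *m T *m C) 0 j = (Z 0 (s j) - y) * (w *m C) 0 j.
Proof. by rewrite !mulmxA mulCK mul_mx_diag !mxE mulrC. Qed.

Lemma cone_scaleE (w : 'rV_m) i :
  (w *m T *m W) 0 i = (Z 0 i - y) * (w *m W) 0 i.
Proof. by rewrite mulmx_block cone_scaleC -mulmx_block -Zb. Qed.

Lemma mulC_inj k (q q' : 'M_(k, m)) : q *m C = q' *m C -> q = q'.
Proof.
by move=> e; rewrite -[q]mulmx1 -CK mulmxA e -mulmxA CK mulmx1.
Qed.

Lemma cone_scale_inj (w w' : 'rV_m) :
  (forall i, Z 0 i - y != 0) -> w *m T = w' *m T -> w = w'.
Proof.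
move=> Zy e; apply: mulC_inj; apply/rowP => j; apply: (mulfI (Zy (s j))).
by rewrite -!cone_scaleC e.
Qed.

Lemma lincombE k (x : S) (p q : 'rV_m) (M : 'M_(m, k)) i :
  ((x *: p + q) *m M) 0 i = x * (p *m M) 0 i + (q *m M) 0 i.
Proof. by rewrite mulmxDl -scalemxAl mxE; congr (_ + _); rewrite mxE. Qed.

(** With [u = w *m W], the vertex values are [x + (Z_i - y) u_i], and their difference along an edge
    is [(Z_j - y) (u_i - u_j) + (Z_i - Z_j) u_i]. The premise cancels [Z_j - y], so [q] is a spline
    iff [w] is. *)
Lemma cone_splineP E (q : 'rV_m) x :
    (forall i j w g, (Z 0 j - y) * w = (Z 0 i - Z 0 j) * g ->
       exists h, w = (Z 0 i - Z 0 j) * h) ->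
  spline E Z (q *m W) /\ (forall i, exists g, (q *m W) 0 i -
    x = (Z 0 i - y) * g) <->
  exists2 w : 'rV_m, q = x *: cone_one + w *m T & spline E Z (w *m W).
Proof.
move=> cancel; split=> [[splq dvdq]|[w -> splw]]; last first.
  have qE i : ((x *: cone_one + w *m T) *m W) 0 i = x + (Z 0
    i - y) * (w *m W) 0 i.
    by rewrite lincombE cone_oneE cone_scaleE mulr1.
  split=> [i j Eij|i]; last by exists ((w *m W) 0 i); rewrite qE addrC addKr.
  have [g e] := splw i j Eij; exists ((w *m W) 0 i + (Z 0 j - y) * g).
  by rewrite !qE mulrDr mulrCA -e; ring.
(* Quotients are chosen only at the columns [s j]: they determine [w] since [C] is invertible, and
   repeated columns give the other vertices. *)
have /fin_all_exists[u uE] j := dvdq (s j).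
have [w wC] : exists w : 'rV_m, w *m C = \row_j u j.
  by exists ((\row_j u j) *m C'); rewrite mulCK.
have qE i : (q *m W) 0 i = x + (Z 0 i - y) * (w *m W) 0 i.
  rewrite mulmx_block mulmx_colsub [(w *m W) 0 i]mulmx_block wC mxE Zb -uE.
  by rewrite addrC subrK.
exists w.
  apply: mulC_inj; apply/rowP => j; rewrite mulmx_colsub qE.
  by rewrite lincombE mulCK cone_scaleC mulmx_colsub [const_mx _ _ _]mxE mulr1.
move=> i j Eij; have [g] := splq i j Eij; rewrite !qE => e.
apply: (cancel i j _ (g - (w *m W) 0 i)).
by rewrite [RHS]mulrBr -e; ring.
Qed.
End ConeAlgebra.

(** * Appending the apex coordinate *)

Definition mx_rcons (S : Type) k n (M : 'M[S]_(k, n)) (c : 'cV[S]_k) :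
  'M_(k, n.+1) :=
  \matrix_(i, j) oapp (M i) (c i 0) (unlift ord_max j).

(** If [W] is the matrix of phi : K^m -> K^n, this is the matrix of phi x id. *)
Definition cone_mx (S : pzRingType) m n (W : 'M[S]_(m, n)) :
  'M[S]_(m.+1, n.+1) :=
  \matrix_(a, i) match unlift ord_max a, unlift ord_max i with
                 | Some a', Some i' => W a' i'
                 | None, None => 1
                 | _, _ => 0
                 end.

Lemma lift_max_widen n (i : 'I_n) : lift ord_max i = widen_ord (leqnSn n) i.
Proof. by apply: val_inj; exact: lift_max. Qed.

Section Rcons.
Variable S : pzRingType.

Lemma mx_rcons_lift k n (M : 'M[S]_(k, n)) c i j :
  mx_rcons M c i (lift ord_max j) = M i j.
Proof. by rewrite mxE liftK. Qed.

Lemma mx_rcons_max k n (M : 'M[S]_(k, n)) c i : mx_rcons M c i ord_max = c i 0.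
Proof. by rewrite mxE unlift_none. Qed.

Lemma mx_rconsK k n (M : 'M[S]_(k, n.+1)) :
  mx_rcons (col' ord_max M) (col ord_max M) = M.
Proof.
apply/matrixP=> i j; case: (unliftP ord_max j) => [j'|] ->.
  by rewrite mx_rcons_lift mxE.
by rewrite mx_rcons_max mxE.
Qed.

Lemma mx_rcons_inj k n (M M' : 'M[S]_(k, n)) c c' :
  mx_rcons M c = mx_rcons M' c' -> M = M' /\ c = c'.
Proof.
move=> /matrixP e; split; apply/matrixP => i j.
  by have := e i (lift ord_max j); rewrite !mx_rcons_lift.
by have := e i ord_max; rewrite !mx_rcons_max ord1.
Qed.

Lemma mulmx_rcons k l n (A : 'M[S]_(k, l)) (M : 'M_(l, n)) c :
  A *m mx_rcons M c = mx_rcons (A *m M) (A *m c).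
Proof.
apply/matrixP=> i j; case: (unliftP ord_max j) => [j'|] ->.
  by rewrite mx_rcons_lift !mxE; apply: eq_bigr => a _; rewrite mx_rcons_lift.
by rewrite mx_rcons_max !mxE; apply: eq_bigr => a _; rewrite mx_rcons_max.
Qed.

Lemma mx_rconsD k n (M M' : 'M[S]_(k, n)) c c' :
  mx_rcons M c + mx_rcons M' c' = mx_rcons (M + M') (c + c').
Proof.
apply/matrixP=> i j; case: (unliftP ord_max j) => [j'|] ->.
  by rewrite mxE !mx_rcons_lift mxE.
by rewrite mxE !mx_rcons_max mxE.
Qed.

Lemma row_rcons k n (M : 'M[S]_(k, n)) c i :
  row i (mx_rcons M c) = mx_rcons (row i M) (row i c).
Proof. by rewrite !rowE mulmx_rcons. Qed.

Lemma mul_rcons_cone k m n (p : 'M[S]_(k, m)) c (W : 'M_(m, n)) :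
  mx_rcons p c *m cone_mx W = mx_rcons (p *m W) c.
Proof.
apply/matrixP=> i j; rewrite mxE big_ord_recr /= mx_rcons_max.
rewrite (eq_bigr (fun a => p i a * cone_mx W (lift ord_max a) j)); last first.
  by move=> a _; rewrite -lift_max_widen mx_rcons_lift.
case: (unliftP ord_max j) => [j'|] ->.
  rewrite mx_rcons_lift mxE unlift_none liftK mulr0 addr0 mxE.
  by apply: eq_bigr => a _; rewrite mxE !liftK.
rewrite mx_rcons_max mxE !unlift_none mulr1 big1 ?add0r // => a _.
by rewrite mxE liftK unlift_none mulr0.
Qed.

Lemma spline_rcons n (G : sgraph n) (Z r : 'rV[S]_n) (y x : 'M_1) :
  spline (edge (cone G)) (mx_rcons Z y) (mx_rcons r x) <->
  spline (edge G) Z r /\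
  forall i, exists g, r 0 i - x 0 0 = (Z 0 i - y 0 0) * g.
Proof.
split=> [spl|[spl dvd] i j].
  split=> [i j Eij|i].
    have := spl (lift ord_max i) (lift ord_max j).
    by rewrite !mx_rcons_lift; apply; rewrite /= /cone_edge !liftK.
  have := spl (lift ord_max i) ord_max.
  by rewrite !mx_rcons_lift !mx_rcons_max; apply; rewrite /=
    /cone_edge liftK unlift_none.
case: (unliftP ord_max i) => [i'|] ->; case: (unliftP ord_max j) => [j'|] ->;
  rewrite /= /cone_edge ?liftK ?unlift_none ?mx_rcons_lift ?mx_rcons_max //.
- exact: spl.
- by have [g e] := dvd j'; exists g; rewrite -opprB e -mulNr opprB.
Qed.

End Rcons.

Lemma map_cone_mx (S S' : pzRingType) (f : {rmorphism S -> S'}) m n (W :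
  'M[S]_(m, n)) :
  map_mx f (cone_mx W) = cone_mx (map_mx f W).
Proof.
apply/matrixP=> a i; rewrite !mxE.
by case: unlift => [a'|]; case: unlift => [i'|]; rewrite ?mxE ?rmorph1 ?rmorph0.
Qed.

Lemma mulmx_homog (K : fieldType) N k l o d e
    (A : 'M[{mpoly K[N]}]_(k, l)) (B : 'M_(l, o)) i j :
  (forall a, A i a \is d.-homog) -> (forall a, B a j \is e.-homog) ->
  (A *m B) i j \is (d + e).-homog.
Proof. by move=> hA hB; rewrite mxE; apply: rpred_sum => a _; apply:
  dhomogM. Qed.

Lemma mpolyC_homog (K : fieldType) N (c : K) : (c%:MP :
  {mpoly K[N]}) \is 0.-homog.
Proof. by rewrite -[c%:MP]mulr1 mul_mpolyC rpredZ // dhomog1. Qed.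

Lemma var_homog (K : fieldType) N (i : 'I_N) : ('X_i :
  {mpoly K[N]}) \is 1.-homog.
Proof. by rewrite dhomogX /= mdeg1. Qed.

Lemma vars_rcons (K : fieldType) m :
  vars m.+1 K = mx_rcons (vars m K)^w (const_mx 'X_ord_max).
Proof.
apply/rowP => a; case: (unliftP ord_max a) => [a'|] ->.
  by rewrite mx_rcons_lift map_mxE !mxE mwidenX mnmwiden1 lift_max_widen.
by rewrite mx_rcons_max !mxE.
Qed.

Lemma spline_map (S S' : pzRingType) (f : {rmorphism S -> S'}) n E (Z r :
  'rV[S]_n) :
  spline E Z r -> spline E (map_mx f Z) (map_mx f r).
Proof.
by move=> spl i j /spl[g e]; exists (f g); rewrite !mxE -!rmorphB e rmorphM.
Qed.

(** * The basis for the cone *)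

Section ConeBasis.
Variables (K : fieldType) (n m r : nat) (G : sgraph n) (W : 'M[K]_(m, n)).
Variables (s : 'I_m -> 'I_n) (b : 'I_n -> 'I_m) (d : nat -> nat).
Variable P : 'M[{mpoly K[m]}]_(r, m).
Hypothesis unitC : colsub s W \in unitmx.
Hypothesis Wb : forall a i, W a i = W a (s (b i)).
Hypothesis basisP : spline_basis (edge G) W d P.

Let S := {mpoly K[m.+1]}.
Let y : S := 'X_ord_max.
Let C' : 'M[S]_m := (invmx (colsub s W))^M.
Let Z : 'rV[S]_n := (vars m K *m W^M)^w.
Let T := cone_scale s W^M C' Z y.
Let o := cone_one C'.

Let CK : colsub s (W^M : 'M[S]_(m, n)) *m C' = 1%:M.
Proof. by rewrite -map_mxsub -map_mxM mulmxV // map_mx1. Qed.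

Let WbM a i : (W^M : 'M[S]_(m, n)) a i = W^M a (s (b i)).
Proof. by rewrite !map_mxE Wb. Qed.

Let Zb i : Z 0 i = Z 0 (s (b i)).
Proof.
rewrite !map_mxE; congr mwiden; rewrite !mxE; apply: eq_bigr => a _.
by rewrite !map_mxE Wb.
Qed.

Let cancel i j (w g : S) : (Z 0 j - y) * w = (Z 0 i - Z 0 j) * g ->
  exists h, w = (Z 0 i - Z 0 j) * h.
Proof. by rewrite !map_mxE -mwidenB; apply: mwiden_dvd_cancel. Qed.

Lemma spline_coneP (q : 'rV[S]_m) (c : 'M_1) :
  spline (edge (cone G)) (vars m.+1 K *m (cone_mx W)^M)
    (mx_rcons q c *m (cone_mx W)^M) <->
  exists2 w : 'rV_m, q = c 0 0 *: o + w *m T & spline (edge G) Z (w *m W^M).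
Proof.
rewrite map_cone_mx vars_rcons !mul_rcons_cone -map_mwidenC -map_mwidenM.
rewrite spline_rcons mxE map_mwidenC.
by apply: (cone_splineP CK WbM Zb); exact: cancel.
Qed.

(** By [spline_coneP] a spline with apex value [c] has the form [c o + w T], and [w] expands
    uniquely in the widened [P]. Since [T] has degree 1, the old exponents rise by one, while the
    row of ones contributes 0. *)
Lemma cone_basis : exists P' : 'M_(1 + r, m.+1),
  spline_basis (edge (cone G)) (cone_mx W)
    (fun k => if k is k'.+1 then (d k').+1 else 0%N) P'.
Proof.
have [splP homP _] := basisP.
exists (col_mx (mx_rcons o 1) (mx_rcons (P^w *m T) 0)); split.
- move=> k; case: (split_ordP k) => k' ->.
    rewrite rowKu row_rcons spline_coneP; exists 0.
      by rewrite mul0mx addr0 ord1 mxE mxE scale1r row_id.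
    by move=> i j _; exists 0; rewrite mul0mx !mxE subrr mulr0.
  rewrite rowKd row_rcons spline_coneP; exists (row k' P^w).
    by rewrite mxE mxE scale0r add0r row_mul.
  have -> : row k' P^w *m W^M = (row k' P *m W^M)^w.
    by rewrite map_mwidenM map_mwidenC map_row.
  exact: (@spline_map _ _ (@mwiden m K)).
- have hC i j : C' i j \is 0.-homog.
    by rewrite map_mxE mpolyC_homog.
  have hW i j : (W^M : 'M[{mpoly K[m]}]_(m, n)) i j \is 0.-homog.
    by rewrite map_mxE mpolyC_homog.
  have hZ i : Z 0 i \is 1.-homog.
    rewrite map_mxE; apply: mwiden_homog.
    by apply: (mulmx_homog (d := 1) (e := 0)) => // ?; rewrite mxE var_homog.
  move=> k a; case: (split_ordP k) => k' ->; case: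
    (unliftP ord_max a) => [a'|] ->.
  + rewrite col_mxEu mx_rcons_lift ord1 /=.
    by apply: (mulmx_homog (d := 0) (e := 0)) => // i; rewrite mxE dhomog1.
  + by rewrite col_mxEu mx_rcons_max mxE ord1 dhomog1.
  + rewrite col_mxEd mx_rcons_lift /= -[(d k').+1]addn1.
    apply: mulmx_homog => [i|i]; first by rewrite map_mxE;
      apply/mwiden_homog/homP.
    (* Of the three factors of [T], only the diagonal one has positive degree, namely 1. *)
    apply: (mulmx_homog (d := 1) (e := 0)) => // j'.
    apply: (mulmx_homog (d := 0) (e := 1)) => [j|j];
      first by rewrite -map_mxsub map_mxE mpolyC_homog.
    by rewrite mxE rpredMn // mxE; apply: rpredB; [exact: hZ | exact:
      var_homog].
  + by rewrite col_mxEd mx_rcons_max mxE rpred0.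
- move=> q'; rewrite -[q']mx_rconsK; move: (col' _ _) (col _ _) => q c.
  move=> /spline_coneP[w def_q splw].
  have [F [def_w uniqF]] := widen_basis basisP splw.
  have rowP' (c' : 'M_1) F' :
      row_mx c' F' *m col_mx (mx_rcons o 1) (mx_rcons (P^w *m T) 0)
      = mx_rcons (c' 0 0 *: o + F' *m P^w *m T) c'.
    rewrite mul_row_col !mulmx_rcons mx_rconsD mulmx1 mulmx0 addr0.
    by rewrite -[F' *m P^w *m T]mulmxA -mul_scalar_mx -mx11_scalar.
  exists (row_mx c F); split; first by rewrite rowP' -def_w -def_q.
  move=> f; rewrite -[f]hsubmxK rowP' => /mx_rcons_inj[e ec];
    rewrite -{}ec in e *; congr row_mx.
  (* [T] is injective because no [Z_i - y] vanishes. *)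
  apply: uniqF; apply: (cone_scale_inj CK (Z := Z) (y := y)).
    by move=> i; rewrite map_mxE mwidenB_last_neq0.
  by apply: (addrI (c 0 0 *: o)); exact: etrans (esym def_q) e.
Qed.
End ConeBasis.

(** * Derivations as splines *)

Section Derivations.
Variables (K : fieldType) (m : nat).
Local Notation S := {mpoly K[m]}.
Implicit Types (p : 'rV[S]_m) (f g : S).

Definition vfield p f : S := \sum_a p 0 a * f^`M(a).

Lemma vfield_linear p : linear (vfield p).
Proof.
move=> c f g; rewrite /vfield scaler_sumr -big_split; apply: eq_bigr => a _ /=.
by rewrite mderivD mderivZ mulrDr scalerAr.
Qed.

HB.instance Definition _ p := GRing.isLinear.Build K S S _
  (vfield p) (vfield_linear p).

Lemma vfield_derivation p : derivation (vfield p).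
Proof.
split=> [|f g]; first exact: vfield_linear.
rewrite /vfield mulr_suml mulr_sumr -big_split; apply: eq_bigr => a _ /=.
by rewrite mderivM; ring.
Qed.

Lemma vfieldX p a : vfield p 'X_a = p 0 a.
Proof.
rewrite /vfield (bigD1 a) //= mderivX mnm1E eqxx scale1r.
rewrite -[X in (X - _)%MM]add0m addmK mpolyX0 mulr1.
rewrite big1 ?addr0 // => b ba.
by rewrite mderivX mnm1E eq_sym (negPf ba) scale0r mulr0.
Qed.

Lemma vfieldK p : (\row_a vfield p 'X_a : 'rV_m) = p.
Proof. by apply/rowP => a; rewrite mxE vfieldX. Qed.

(** Both sides are K-linear, vanish on 1 and agree on the variables; the Leibniz rule extends this
    to monomials. *)
Lemma derivationE theta f :
  derivation theta -> theta f = vfield (\row_a theta 'X_a) f.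
Proof.
move=> [lin_th mul_th]; set p := \row_a _.
have [_ mul_p] := vfield_derivation p.
have th1 : theta 1 = 0.
  by apply: (addrI (theta 1)); rewrite addr0 -{3}[1]mulr1 mul_th mulr1 mul1r.
have p1 : vfield p 1 = 0.
  by apply: (addrI (vfield p 1)); rewrite addr0 -{3}[1]mulr1 mul_p mulr1 mul1r.
have agreeM g h : theta g = vfield p g -> theta h = vfield p h ->
    theta (g * h) = vfield p (g * h).
  by move=> eg eh; rewrite mul_th mul_p eg eh.
elim/mpolyind: f => [|c mm f _ _ ih].
  rewrite linear0; apply: (addrI (theta 0)).
  by have := lin_th 1 0 0; rewrite !scale1r !addr0.
rewrite lin_th linearP ih; congr (_ *: _ + _).
rewrite mpolyXE_id; apply: (big_ind (fun g => theta g = vfield p g)).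
- by rewrite th1 p1.
- exact: agreeM.
move=> i _; elim: (mm i) => [|k ihk]; first by rewrite expr0 th1 p1.
by rewrite exprS; apply: agreeM; rewrite // vfieldX mxE.
Qed.

Lemma vfield_form p (alpha : 'Hom('rV[K]_m, K^o)) :
  vfield p (form_poly alpha) = \sum_a (alpha (delta_mx 0 a) : K) *: p 0 a.
Proof.
by rewrite linear_sum; apply: eq_bigr => a _; rewrite linearZ /= vfieldX.
Qed.

(** [in_D] quantifies over all forms with a given kernel, whereas an edge supplies just one. If
    [beta v] is nonzero, [u - (beta u / beta v) v] lies in the common kernel. *)
Lemma eq_lker_scale (V : vectType K) (alpha beta : 'Hom(V, K^o)) :
  lker alpha = lker beta -> exists c : K, forall u, alpha u = c * beta u.
Proof.
move=> e; have linE (gamma : 'Hom(V, K^o)) (c : K) u v : gamma (u - c *: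
  v) = gamma u - c * gamma v.
  by rewrite linearB linearZ.
have [/subvP b0|] := boolP (fullv <= lker beta)%VS.
  exists 0 => u; rewrite mul0r; apply/eqP.
  by rewrite -memv_ker e b0 ?memvf.
case/subvPn=> v _; rewrite memv_ker => bv.
exists (alpha v / beta v) => u.
have : u - (beta u / beta v : K) *: v \in lker beta.
  by rewrite memv_ker linE mulfVK // subrr.
rewrite -e memv_ker linE subr_eq0 => /eqP ->.
by rewrite mulrC mulrA [RHS]mulrAC.
Qed.

End Derivations.

(** * The dictionary between free arrangements and spline bases *)

Section FreeSpline.
Variables (K : fieldType) (m n : nat) (E : rel 'I_n).
Variables (phi : 'Hom('rV[K]_m, 'rV[K]_n)) (A : arrangement K m).
Local Notation W := (lin1_mx phi).
Local Notation diff i j := (linfun (coord_diff (K := K) i j) \o phi)%VF.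
Hypothesis A_diff : forall H, H \in A -> exists i j, E i j /\
  H = lker (diff i j).
Hypothesis diff_A : forall i j, E i j ->
  (forall u, phi u 0 i = phi u 0 j) \/ lker (diff i j) \in A.

Let diffE i j u : diff i j u = phi u 0 i - phi u 0 j.
Proof. by rewrite comp_lfunE lfunE. Qed.

Lemma mulmx_lin1C N (p : 'rV[{mpoly K[N]}]_m) i :
  (p *m W^M) 0 i = \sum_a (phi (delta_mx 0 a) 0 i) *: p 0 a.
Proof.
rewrite mxE; apply: eq_bigr => a _.
by rewrite map_mxE mulrC mul_mpolyC [W a i]mxE.
Qed.

Lemma form_diff i j :
  form_poly (diff i j) = (vars m K *m W^M) 0 i - (vars m K *m W^M) 0 j.
Proof.
rewrite !mulmx_lin1C -sumrB; apply: eq_bigr => a _.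
by rewrite diffE scalerBl !mxE.
Qed.

Lemma vfield_diff p i j :
  vfield p (form_poly (diff i j)) = (p *m W^M) 0 i - (p *m W^M) 0 j.
Proof.
rewrite vfield_form !mulmx_lin1C -sumrB; apply: eq_bigr => a _.
by rewrite diffE scalerBl.
Qed.

(** An edge whose form vanishes after composition with [phi] need not give a hyperplane of [A], but
    its spline condition is then 0 = 0. *)
Lemma in_D_spline theta : derivation theta ->
  in_D A theta <-> spline E (vars m K *m W^M) ((\row_a theta 'X_a) *m W^M).
Proof.
move=> der; split=> [[_ dvd] i j Eij|spl].
  have [same|HA] := diff_A Eij.
    exists 0; rewrite mulr0 !mulmx_lin1C -sumrB big1 // => a _.
    by rewrite same subrr.
  have [g e] := dvd _ _ HA erefl; exists g.
  by rewrite -vfield_diff -form_diff -e -derivationE.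
split=> // H alpha /A_diff[i [j [Eij ->]]] /eq_lker_scale[c eq_alpha].
have formE : form_poly alpha = c *: form_poly (diff i j).
  by rewrite scaler_sumr; apply: eq_bigr => a _; rewrite eq_alpha scalerA.
have [g e] := spl i j Eij; exists g.
by rewrite formE derivationE // linearZ /= vfield_diff e form_diff scalerAl.
Qed.

(** The number of rows is a separate [r], so that [1 + size e] can serve for the shifted list of
    exponents. *)
Lemma free_spline r e : size e = r ->
  free_with_exponents A e <->
  exists P : 'M_(r, m), spline_basis E W (fun k => nth 0%N e k) P.
Proof.
move=> <-{r}; split=> [[theta [inD homog_th basis_th]]|[P [splP homP basisP]]].
  have der k : derivation (theta k) by have [] := inD k.
  pose P := \matrix_(k, a) theta k 'X_a.
  have rowPE k : row k P = \row_a theta k 'X_a by apply/rowP => a; rewrite !mxE.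
  exists P; split=> [k|k a|q splq].
  - by rewrite rowPE -in_D_spline.
  - by rewrite mxE; apply: homog_th.
  have /basis_th[f [f_q uniq_f]] : in_D A (vfield q).
    rewrite in_D_spline; last exact: vfield_derivation.
    by rewrite vfieldK.
  exists (\row_k f k); split=> [|F qF].
    apply/rowP => a; rewrite -[LHS]vfieldX f_q mxE.
    by apply: eq_bigr => k _; rewrite !mxE.
  suff -> : f = [ffun k => F 0 k] by apply/rowP => k; rewrite !mxE ffunE.
  apply: uniq_f => p; rewrite qF /vfield.
  under [RHS]eq_bigr => k _ do rewrite ffunE (derivationE _
    (der k)) /vfield mulr_sumr.
  rewrite exchange_big; apply: eq_bigr => a _ /=.
  rewrite mxE mulr_suml; apply: eq_bigr => k _.
  by rewrite !mxE mulrA.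
exists (fun k => vfield (row k P)); split=> [k|k a|eta inD_eta].
- rewrite in_D_spline; last exact: vfield_derivation.
  by rewrite vfieldK.
- by rewrite vfieldX mxE.
have [der _] := inD_eta.
have /basisP[F [qF uniqF]] := (in_D_spline der).1 inD_eta.
exists [ffun k => F 0 k]; split=> [p|f f_eta].
  rewrite (derivationE _ der) qF /vfield.
  under [RHS]eq_bigr => k _ do rewrite ffunE mulr_sumr.
  rewrite exchange_big; apply: eq_bigr => a _ /=.
  rewrite mxE mulr_suml; apply: eq_bigr => k _.
  by rewrite !mxE mulrA.
apply/ffunP => k; rewrite ffunE (uniqF (\row_k f k)) ?mxE //.
apply/rowP => a; rewrite mxE f_eta [RHS]mxE; apply: eq_bigr => l _.
by rewrite vfieldX !mxE.
Qed.
End FreeSpline.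

(** * Flats of graphic arrangements *)

Section Graphic.
Variables (K : fieldType) (n : nat) (G : sgraph n).
Local Notation diff i j := (linfun (coord_diff (K := K) i j)).

Lemma graphicP H :
  reflect (exists i j, edge G i j /\ H = lker (diff i j)) (H \in graphic K G).
Proof.
apply: (iffP (imfsetP _ _ _ _)) => [[[i j] /= Eij ->]|[i [j [Eij ->]]]];
  first by exists i, j.
by exists (i, j).
Qed.

Lemma mem_lker_diff i j (v : 'rV[K]_n) : (v \in lker (diff i
  j)) = (v 0 i == v 0 j).
Proof. by rewrite memv_ker lfunE subr_eq0. Qed.

(** The edges dropped by the restriction are those whose form vanishes on [X], which [free_spline]
    allows. *)
Lemma restriction_spline m (phi : 'Hom('rV[K]_m, 'rV[K]_n)) X e r :
    limg phi = X -> size e = r ->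
  free_with_exponents [fset (phi @^-1: H)%VS | H in
    restriction (graphic K G) X]%fset e
  <-> exists P : 'M_(r, m), spline_basis (edge G) (lin1_mx
    phi) (fun k => nth 0%N e k) P.
Proof.
move=> limX; have phiX u : phi u \in X by rewrite -limX memv_img ?memvf.
have preim i j : (phi @^-1: (lker (diff i j) :&: X) = lker
  (diff i j \o phi))%VS.
  apply/vspaceP => u; rewrite -memv_preim memv_cap phiX andbT !memv_ker.
  by rewrite comp_lfunE.
apply: free_spline => [H /imfsetP[H1 /= /imfsetP[H0 /= /andP[]]]|i j Eij].
  by case/graphicP=> [i [j [Eij ->]]] _ -> ->; exists i, j; rewrite preim.
have [/subvP XH|XH] := boolP (X <= lker (diff i j))%VS; [left|right].
  by move=> u; apply/eqP; rewrite -mem_lker_diff XH.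
apply/imfsetP; exists (lker (diff i j) :&: X)%VS => //=.
apply/imfsetP; exists (lker (diff i j)) => //=; rewrite inE /= XH andbT.
by apply/graphicP; exists i, j.
Qed.

Lemma graphic_spline e r : size e = r ->
  free_with_exponents (graphic K G) e
  <-> exists P : 'M_(r, n), spline_basis (edge G) (1%:M :
    'M[K]_n) (fun k => nth 0%N e k) P.
Proof.
have <- : lin1_mx (\1%VF : 'End('rV[K]_n)) = 1%:M.
  by apply/row_matrixP => i; rewrite !rowE mul_rV_lin1 /= id_lfunE mulmx1.
apply: free_spline => [H /graphicP[i [j [Eij ->]]]|i j Eij].
  by exists i, j; rewrite comp_lfun1r.
by right; rewrite comp_lfun1r; apply/graphicP; exists i, j.
Qed.

Lemma memv_bigcap (B : arrangement K n) (v : 'rV[K]_n) :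
  reflect (forall H, H \in B -> v \in H) (v \in (\bigcap_(H <- B) H)%VS).
Proof.
rewrite big_seq; apply: (iffP idP) => [vB H HB|vB].
  move: vB; rewrite memvE; move/subv_trans; apply.
  by rewrite (big_rem H) //= HB capvSl.
by rewrite memvE; elim/big_rec: _ => [|H U HB vU];
  rewrite ?subvf // subv_cap -memvE vB.
Qed.

(** Each hyperplane cutting out [X] is itself a coordinate equality valid on [X]. *)
Lemma flat_saturated X (v : 'rV[K]_n) : flat (graphic K G) X ->
    (forall i j, (forall u, u \in X -> u 0 i = u 0 j) -> v 0 i = v 0 j) ->
  v \in X.
Proof.
move=> [B /fsubsetP BG ->] sat; apply/memv_bigcap => H HB.
have /graphicP[i [j [_ defH]]] := BG _ HB.
rewrite defH mem_lker_diff; apply/eqP/sat => u /memv_bigcap/(_ _ HB).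
by rewrite defH mem_lker_diff => /eqP.
Qed.

(* Take [m] independent columns of [W].  If column [i]
  equalled none of them, the
   indicator vector of the coordinates agreeing with [i] on
     the flat would lie in
   the flat and vanish at these [m] columns, hence be zero. *)
Lemma flat_coordinates m (phi : 'Hom('rV[K]_m, 'rV[K]_n)) :
    lker phi = 0%VS -> flat (graphic K G) (limg phi) ->
  exists (s : 'I_m -> 'I_n) (b : 'I_n -> 'I_m),
    colsub s (lin1_mx phi) \in unitmx /\
    forall a i, lin1_mx phi a i = lin1_mx phi a (s (b i)).
Proof.
set W := lin1_mx phi => /eqP/lker0P inj_phi flatX.
have free_W : row_free W.
  by apply: inj_row_free => v; rewrite mul_rV_lin1 -(linear0 phi); apply:
    inj_phi.
have full_WT : row_full W^T by rewrite /row_full mxrank_tr.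
(* [W] has rank [m], so [fullrankfun] selects [m] independent columns. *)
pose s : 'I_m -> 'I_n := fullrankfun full_WT.
have unitC : colsub s W \in unitmx.
  by rewrite -unitmx_tr trmx_mxsub fullrowsub_unit.
suff /fin_all_exists[b Wb] i : exists j, forall a, W a i = W a (s j).
  by exists s, b; split.
have [/existsP[j /forallP Wj]|no_j] := boolP [exists j,
  [forall a, W a i == W a (s j)]].
  by exists j => a; apply/eqP.
pose v : 'rV[K]_n := \row_k [forall a, W a i == W a k]%:R.
have /memv_imgP[z _ vz] : v \in limg phi.
  apply: (flat_saturated flatX) => k l same; rewrite !mxE; congr (_%:R).
  congr (nat_of_bool _); apply: eq_forallb => a; congr (_ == _).
  by rewrite !mxE same // memv_img ?memvf.
have z0 : z = 0.
  apply: (row_free_inj (A := colsub s W)); first by rewrite row_free_unit.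
  rewrite mul0mx; apply/rowP => j.
  have -> : (z *m colsub s W) 0 j = (z *m W) 0 (s j).
    by rewrite !mxE; apply: eq_bigr => a _; rewrite [colsub s W a j]mxE.
  rewrite mul_rV_lin1 /= -vz !mxE; case: forallP => // Wij.
  by case/existsP: no_j; exists j; apply/forallP.
(* Yet the indicator vector is 1 at [i] itself. *)
move: vz; rewrite z0 linear0 => /rowP/(_ i); rewrite !mxE.
by case: forallP => [_ /eqP|[]] //; rewrite oner_eq0.
Qed.
End Graphic.

(** * Witnesses for the cone *)

Lemma eq_spline_basis (K : fieldType) m n r (E : rel 'I_n) (W :
  'M[K]_(m, n)) (d d' : nat -> nat)
    (P : 'M_(r, m)) :
    (forall k : 'I_r, d k = d' k) ->
  spline_basis E W d P -> spline_basis E W d' P.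
Proof. by move=> eq_d [spl hom basis]; split=> // k a; rewrite -eq_d. Qed.

(** [free_in] fixes the domain K^(dim X); a parametrisation by K^m is transported along
    [\dim X = m]. *)
Lemma free_in_dim (K : fieldType) n m (phi : 'Hom('rV[K]_m, 'rV[K]_n)) X B e :
    lker phi = 0%VS -> limg phi = X ->
    free_with_exponents [fset (phi @^-1: H)%VS | H in B]%fset e ->
  \dim X = m /\ free_in X B e.
Proof.
move=> ker0 limX free.
have dimX : \dim X = m.
  by rewrite -limX limg_dim_eq ?ker0 ?capv0 // dimvf dim_matrix [LHS]mul1n.
split=> //; rewrite /free_in; case: _ / (esym dimX) phi ker0 limX free.
by move=> phi ker0 limX free; exists phi.
Qed.

Section ConeWitness.
Variables (K : fieldType) (n : nat) (G : sgraph n).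
Local Notation graph := (graphic K G).
Local Notation cgraph := (graphic K (cone G)).

(** This is X x K, the apex coordinate being unconstrained. *)
Definition cone_flat (X : {vspace 'rV[K]_n}) : {vspace 'rV[K]_n.+1} :=
  (linfun (@col' K 1 n.+1 ord_max) @^-1: X)%VS.

Lemma mem_cone_flat X v : (v \in cone_flat X) = (col' ord_max v \in X).
Proof. by rewrite -memv_preim lfunE. Qed.

Lemma cone_flatP X : flat graph X -> flat cgraph (cone_flat X).
Proof.
move=> [B /fsubsetP BG ->]; exists [fset cone_flat H | H in B]%fset.
  apply/fsubsetP => _ /imfsetP[H /= /BG/graphicP[i [j [Eij ->]]] ->].
  apply/graphicP; exists (lift ord_max i), (lift ord_max j).
  split; first by rewrite /= /cone_edge !liftK.
  by apply/vspaceP => v; rewrite mem_cone_flat !mem_lker_diff !mxE.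
apply/vspaceP => v; rewrite mem_cone_flat; apply/memv_bigcap/memv_bigcap.
  by move=> vB _ /imfsetP[H /= HB ->]; rewrite mem_cone_flat vB.
by move=> vB H HB; rewrite -mem_cone_flat; apply/vB/imfsetP; exists H.
Qed.

Lemma cone_flatS X Y : (X <= Y)%VS -> (cone_flat X <= cone_flat Y)%VS.
Proof.
by move/subvP=> XY; apply/subvP => v; rewrite !mem_cone_flat; apply: XY.
Qed.

(** If [phi] parametrises [X], then phi x id parametrises X x K and has matrix [cone_mx];
    [flat_coordinates] provides the column data for [cone_basis]. *)
Lemma free_cone_flat X e : flat graph X ->
    free_in X (restriction graph X) e ->
  \dim (cone_flat X) = (\dim X).+1 /\
  free_in (cone_flat X) (restriction cgraph (cone_flat X)) (0%N :: map S e).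
Proof.
move=> flatX [phi [ker0 limX]].
have [s [b [unitC Wb]]] : exists s b, colsub s (lin1_mx phi) \in unitmx /\
    forall a i, lin1_mx phi a i = lin1_mx phi a (s (b i)).
  by apply: (flat_coordinates (G := G) ker0); rewrite limX.
move/(restriction_spline G (r := size e) limX erefl) => [P basisP].
have [P' basisP'] := cone_basis unitC Wb basisP.
pose phi' : 'Hom('rV[K]_(\dim X).+1, 'rV[K]_n.+1) :=
  linfun (mulmxr (cone_mx (lin1_mx phi))).
have phi'E z c : phi' (mx_rcons z c) = mx_rcons (phi z) c.
  by rewrite lfunE /= mul_rcons_cone mul_rV_lin1.
have inj_phi' : lker phi' = 0%VS.
  apply/eqP/lker0P => u v; rewrite -[u]mx_rconsK -[v]mx_rconsK !phi'E.
  by move/eqP/lker0P: ker0 => inj_phi /mx_rcons_inj[/inj_phi -> ->].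
have lim_phi' : limg phi' = cone_flat X.
  apply/vspaceP => v; rewrite mem_cone_flat.
  have -> : (col' ord_max v \in X) = (col' ord_max v \in limg
    phi) by rewrite limX.
  apply/memv_imgP/memv_imgP => [[u _ ->]|[z _ vz]].
    exists (col' ord_max u); first exact: memvf.
    rewrite -{1}[u]mx_rconsK phi'E; apply/rowP => i.
    by rewrite mxE mx_rcons_lift.
  exists (mx_rcons z (col ord_max v)); first exact: memvf.
  by rewrite phi'E -vz mx_rconsK.
apply: (free_in_dim inj_phi' lim_phi').
apply/(restriction_spline (cone G) (r := 1 + size e) lim_phi').
  by rewrite /= size_map.
exists P'; have -> : lin1_mx phi' = cone_mx (lin1_mx phi).
  by apply/row_matrixP => i; rewrite !rowE mul_rV_lin1 /= lfunE.
apply: eq_spline_basis basisP' => -[[|k] //= lt_k].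
by rewrite (nth_map 0%N).
Qed.

(** The case of the whole space: [W] is the identity and each column is its own representative. *)
Lemma free_cone e :
  free_with_exponents graph e -> free_with_exponents cgraph (0%N :: map S e).
Proof.
move/(graphic_spline K G (r := size e) erefl) => [P basisP].
apply/(graphic_spline K (cone G) (r := 1 + size e));
  first by rewrite /= size_map.
have [||P' basisP'] := cone_basis (s := id) (b := id) _ _ basisP.
- by rewrite (_ : colsub id 1%:M = 1%:M) ?unitmx1 //; apply/matrixP => i j;
    rewrite mxE.
- by [].
exists P'; have <- : cone_mx 1%:M = 1%:M :> 'M[K]_n.+1.
  apply/matrixP => i j; rewrite !mxE.
  case: (unliftP ord_max i) => [i'|] ->; case: (unliftP ord_max j) => [j'|] ->.
  - by rewrite mxE (inj_eq lift_inj).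
  - by rewrite eq_sym (negPf (neq_lift _ _)).
  - by rewrite (negPf (neq_lift _ _)).
  - by rewrite eqxx.
apply: eq_spline_basis basisP' => -[[|k] //= lt_k].
by rewrite (nth_map 0%N).
Qed.

Definition diagonal : {vspace 'rV[K]_n.+1} := <[const_mx 1]>%VS.

Lemma mem_diagonal v : (v \in diagonal) = [forall i, v 0 i == v 0 ord_max].
Proof.
apply/vlineP/forallP => [[c ->] i|v_const]; first by rewrite !mxE.
exists (v 0 ord_max); apply/rowP => i.
by rewrite !mxE mulr1; apply/eqP.
Qed.

(** The edges through the apex already force a vector to be constant. *)
Lemma diagonal_flat : flat cgraph diagonal.
Proof.
exists cgraph; first exact: fsubset_refl.
apply/vspaceP => v; rewrite mem_diagonal; apply/forallP/memv_bigcap.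
  move=> v_const H /graphicP[i [j [_ ->]]].
  by rewrite mem_lker_diff (eqP (v_const i)) (eqP (v_const j)).
move=> vG i; case: (unliftP ord_max i) => [j|] -> //.
rewrite -mem_lker_diff; apply/vG/graphicP; exists (lift ord_max j), ord_max.
by rewrite /= /cone_edge liftK unlift_none.
Qed.

(** All edge forms vanish on the diagonal, so every derivation qualifies and d/dx is a basis, of
    degree 0. *)
Lemma free_diagonal :
  \dim diagonal = 1 /\ free_in diagonal (restriction cgraph diagonal) [:: 0%N].
Proof.
pose phi : 'Hom('rV[K]_1, 'rV[K]_n.+1) := linfun (mulmxr (const_mx 1)).
have phiE u i : phi u 0 i = u 0 0.
  by rewrite lfunE /= mxE big_ord_recl big_ord0 mxE mulr1 addr0.
have inj_phi : lker phi = 0%VS.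
  apply/eqP/lker0P => u v /rowP/(_ 0); rewrite !phiE => uv.
  by apply/rowP => i; rewrite ord1.
have lim_phi : limg phi = diagonal.
  apply/vspaceP => v; rewrite mem_diagonal; apply/memv_imgP/forallP.
    by case=> u _ -> i; rewrite !phiE.
  move=> v_const; exists (const_mx (v 0 ord_max)); first exact: memvf.
  by apply/rowP => i; rewrite phiE mxE; apply/eqP.
apply: (free_in_dim inj_phi lim_phi).
apply/(restriction_spline (cone G) (e := [:: 0%N]) (r := 1) lim_phi erefl).
have spl (q : 'rV_1) : spline (edge (cone G)) (vars 1 K *m (lin1_mx phi)^M)
    (q *m (lin1_mx phi)^M).
  move=> i j _; exists 0; rewrite mulr0 !mulmx_lin1C -sumrB big1 // => a _.
  by rewrite !phiE subrr.
exists 1%:M; split=> [k|k a|q _]; first exact: spl.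
  by rewrite !ord1 mxE /= dhomog1.
by exists q; split=> [|f ->]; rewrite mulmx1.
Qed.

(** Dimensions rise by one, so index [d] uses [X (d - 1)]; the value at 0 is irrelevant. *)
Definition cone_flats (X : nat -> {vspace 'rV[K]_n}) d :=
  if d is d'.+2 then cone_flat (X d'.+1) else diagonal.

Lemma cone_witness X : witness graph X -> witness cgraph (cone_flats X).
Proof.
move=> [e [free_e sorted_e wit]]; exists [tuple of 0%N :: map S e].
split; first exact: free_cone.
  (* The new exponent 0 is minimal, and the successor preserves the order of the others. *)
  rewrite /= path_min_sorted ?sorted_map //.
  by apply/allP.
case=> [|[|d]] // /andP[_ le_d].
  have [dim1 free1] := free_diagonal.
  by split; [exact: diagonal_flat | | rewrite /= take0].
have [flatX dimX freeX] := wit d.+1 le_d.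
have [dim_c free_c] := free_cone_flat flatX freeX.
split; [exact: cone_flatP | by rewrite dim_c dimX | by
  rewrite map_take in free_c].
Qed.

(** Only the first inclusion is new: constant vectors satisfy every coordinate equality, hence lie
    in X x K for each flat [X]. *)
Lemma cone_chain X m : witness graph X -> (m <= n)%N ->
  chain X m -> chain (cone_flats X) m.+1.
Proof.
move=> [e [_ _ wit]] le_mn chX [|[|d]] //= lt_dm; last exact/cone_flatS/chX.
have [flatX _ _] := wit 1%N (leq_trans (lt_dm : (1 <= m)%N) le_mn).
apply/subvP => v; rewrite mem_diagonal mem_cone_flat => /forallP v_const.
apply: (flat_saturated flatX) => i j _.
by rewrite !mxE !(eqP (v_const _)).
Qed.
End ConeWitness.

Theorem theorem6p15 (K : fieldType) (l : nat) (G : sgraph l) :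
  (forall k : nat, (1 <= k <= l.-1)%N ->
     coaccurate k (graphic K G) -> coaccurate k (graphic K (cone G))) /\
  (accurate (graphic K G) -> accurate (graphic K (cone G))) /\
  (flag_accurate (graphic K G) -> flag_accurate (graphic K (cone G))).
Proof.
split=> [k /andP[k_gt0 le_kl] [_ [X witX chX]]|]; last split.
- have le_k : (k <= l)%N := leq_trans le_kl (leq_pred l).
  split; first by rewrite k_gt0.
  exists (cone_flats X); first exact: cone_witness.
  (* As [k <= l], the required length [l.+1 - k] is [(l - k).+1]: the diagonal prolongs the chain by
     one. *)
  by rewrite subSn //; exact: (cone_chain witX (leq_subr _ _)) chX.
- by case=> X witX; exists (cone_flats X); apply: cone_witness.
by case=> X witX chX; exists (cone_flats X); [exact: cone_witness | exact:
  (cone_chain witX)].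
Qed.
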